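(* For every integer $y\geq 2$ the threefold $\mathcal{W}_2(y)$ is not affine.
   Context: For an integer $y\geq 0$, $\mathcal{W}_2(y)$ denotes the complex threefold obtained by gluing the charts $U=\mathbb{C}^3_{\{z,u_1,u_2\}}$ and $V=\mathbb{C}^3_{\{\xi,v_1,v_2\}}$ by $(\xi,v_1,v_2)=(z^{-1},\,z^2u_1+zu_2^y,\,u_2)$ for $z\neq 0$, $\xi\neq 0$. It is a deformation of $W_2=\mathrm{Tot}(\mathcal{O}_{\mathbb{P}^1}(-2)\oplus\mathcal{O}_{\mathbb{P}^1})$. *)

(* Defs.v *)
From HB Require Import structures.
From mathcomp Require Import all_boot all_algebra.
From mathcomp Require Import generic_quotient complex mpoly.
From mathcomp Require Import boolp classical_sets reals.
From mathcomp Require Import topology_structure initial_topology.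
From mathcomp Require Import subtype_topology quotient_topology sigT_topology.

Set Implicit Arguments.
Unset Strict Implicit.
Unset Printing Implicit Defensive.

Import GRing.Theory.
Local Open Scope classical_set_scope.
Local Open Scope ring_scope.

(* Algebraic varieties are treated classically, as topological spaces carrying
   a sheaf of k-valued functions.  A section over an open set A is represented
   by a total function T -> k of which only the values on A are relevant. *)
Record function_sheaf (k : fieldType) (T : topologicalType)
    (reg : set T -> (T -> k) -> Prop) : Prop := FunctionSheaf {
  reg_eq : forall A f g, open A -> (forall x, A x -> f x = g x) ->
    reg A f -> reg A g;
  reg_sub : forall A B f, open A -> open B -> B `<=` A -> reg A f -> reg B f;
  reg_glue : forall A f, open A ->
    (forall x, A x -> exists B, [/\ open B, B x, B `<=` A & reg B f]) ->
    reg A f;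
  reg_cst : forall A c, open A -> reg A (fun=> c);
  reg_add : forall A f g, open A -> reg A f -> reg A g ->
    reg A (fun x => f x + g x);
  reg_mul : forall A f g, open A -> reg A f -> reg A g ->
    reg A (fun x => f x * g x);
  reg_open_neq0 : forall A f, open A -> reg A f ->
    open (A `&` [set x | f x != 0]);
  reg_inv : forall A f, open A -> reg A f ->
    reg (A `&` [set x | f x != 0]) (fun x => (f x)^-1) }.

Record space_with_functions (k : fieldType) := SpaceWithFunctions {
  space :> topologicalType;
  regular : set space -> (space -> k) -> Prop;
  regular_sheaf : function_sheaf regular }.

Definition morphism (k : fieldType) (X Y : space_with_functions k)
    (phi : X -> Y) : Prop :=
  continuous phi /\
  forall (A : set Y) (f : Y -> k), open A -> regular A f ->
    regular (phi @^-1` A) (f \o phi).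

Definition isomorphic (k : fieldType) (X Y : space_with_functions k) : Prop :=
  exists (phi : X -> Y) (psi : Y -> X),
    [/\ morphism phi, morphism psi, cancel phi psi & cancel psi phi].

(* The alias keeps the Zariski topology apart from any other topology on
   tuples. *)
Definition affine_point (k : fieldType) (n : nat) : Type := n.-tuple k.

HB.instance Definition _ (k : fieldType) (n : nat) :=
  Choice.on (affine_point k n).

Section AffineSpace.
Variables (k : fieldType) (n : nat).
Local Notation point := (affine_point k n).
Implicit Types (x : point) (p q : {mpoly k[n]}).

Definition peval p x : k := p.@[tnth x].

Definition zero_locus (S : set {mpoly k[n]}) : set point :=
  [set x | forall p, S p -> peval p x = 0].

Definition zariski_open (A : set point) : Prop :=
  exists S : set {mpoly k[n]}, ~` A = zero_locus S.

Lemma zariski_openP (A : set point) :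
  zariski_open A <->
  (forall x, A x -> exists p, peval p x != 0 /\
     forall y, peval p y != 0 -> A y).
Proof.
split=> [[S AS] x Ax|H].
  have : ~ zero_locus S x by rewrite -AS.
  move=> /existsNP[p /not_implyP[Sp /eqP px]]; exists p; split => // y py.
  apply: contrapT => nAy; have : (~` A) y by [].
  by rewrite AS => /(_ p Sp) /eqP; apply/negP.
exists [set p | forall y, peval p y != 0 -> A y].
apply/seteqP; split=> [x nAx p /= Hp|x zx Ax].
  by apply/eqP; apply: contra_notT nAx => /Hp.
by have [p [px Hp]] := H x Ax; move/eqP: px; apply; apply: zx.
Qed.

Lemma zariski_openT : zariski_open setT.
Proof.
by apply/zariski_openP => x _; exists 1; rewrite /peval meval1 oner_eq0.
Qed.

Lemma zariski_openI : setI_closed zariski_open.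
Proof.
move=> A B /zariski_openP oA /zariski_openP oB.
apply/zariski_openP => x [/oA[p [px pA]] /oB[q [qx qB]]].
exists (p * q); rewrite /peval mevalM mulf_neq0//; split => // y.
by rewrite mevalM mulf_eq0 negb_or => /andP[/pA ? /qB].
Qed.

Lemma zariski_open_bigU (I : Type) (F : I -> set point) :
  (forall i, zariski_open (F i)) -> zariski_open (\bigcup_i F i).
Proof.
move=> oF; apply/zariski_openP => x [i _ Fx].
have [p [px pF]] := (zariski_openP (F i)).1 (oF i) x Fx.
by exists p; split => // y /pF ?; exists i.
Qed.

HB.instance Definition _ := isOpenTopological.Build point
  zariski_openT zariski_openI zariski_open_bigU.

Definition affine_regular (A : set point) (f : point -> k) : Prop :=
  forall x, A x -> exists (B : set point) p q,
    [/\ open B, B x, B `<=` A &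
        forall y, B y -> peval q y != 0 /\ f y = peval p y / peval q y].

Lemma open_peval p : open [set x : point | peval p x != 0].
Proof. by apply/zariski_openP => x px; exists p. Qed.

Lemma affine_regular_sheaf : function_sheaf affine_regular.
Proof.
split.
- move=> A f g _ fg rf x /rf[B [p [q [oB Bx BA H]]]].
  exists B, p, q; split => // y By; have [qy <-] := H y By.
  by split => //; rewrite -fg//; exact: BA.
- move=> A B f _ oB BA rf x Bx.
  have [C [p [q [oC Cx CA H]]]] := rf x (BA _ Bx).
  exists (C `&` B), p, q; split; [exact: openI|by []|by move=> y []|].
  by move=> y [/H].
- move=> A f _ H x /H[B [oB Bx BA rf]].
  have [C [p [q [oC Cx CB K]]]] := rf x Bx.
  by exists C, p, q; split => //; exact: subset_trans BA.
- move=> A c oA x Ax; exists A, c%:MP, 1; split => // y _.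
  by rewrite /peval mevalC meval1 oner_eq0 divr1.
- move=> A f g _ rf rg x Ax.
  have [B [p [q [oB Bx BA H]]]] := rf x Ax.
  have [C [r [s [oC Cx CA K]]]] := rg x Ax.
  exists (B `&` C), (p * s + r * q), (q * s).
  split; [exact: openI|by []|by move=> y [/BA]|].
  move=> y [/H[qy ->] /K[sy ->]].
  rewrite /peval !(mevalD, mevalM) mulf_neq0//; split => //.
  by rewrite addf_div.
- move=> A f g _ rf rg x Ax.
  have [B [p [q [oB Bx BA H]]]] := rf x Ax.
  have [C [r [s [oC Cx CA K]]]] := rg x Ax.
  exists (B `&` C), (p * r), (q * s).
  split; [exact: openI|by []|by move=> y [/BA]|].
  move=> y [/H[qy ->] /K[sy ->]].
  by rewrite /peval !mevalM mulf_neq0//; split => //; rewrite mulf_div.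
- move=> A f _ rf; rewrite openE => x [Ax fx].
  have [B [p [q [oB Bx BA H]]]] := rf x Ax.
  have [qx fxE] := H x Bx.
  rewrite /interior nbhsE; exists (B `&` [set y | peval p y != 0]).
    split; first by apply: openI => //; exact: open_peval.
    split => //=; apply: contraNneq fx => p0.
    by rewrite fxE p0 mul0r.
  move=> y [By py]; split; first exact: BA.
  by have [qy /= ->] := H y By; rewrite mulf_neq0// invr_eq0.
- move=> A f _ rf x [Ax /= fx].
  have [B [p [q [oB Bx BA H]]]] := rf x Ax.
  have [qx fxE] := H x Bx.
  exists (B `&` [set y | peval p y != 0]), q, p; split.
  + by apply: openI => //; exact: open_peval.
  + split => //=; apply: contraNneq fx => p0.
    by rewrite fxE p0 mul0r.
  + move=> y [By py]; split; first exact: BA.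
    by have [qy /= ->] := H y By; rewrite mulf_neq0// invr_eq0.
  + move=> y [By py]; split => //.
    by have [qy ->] := H y By; rewrite invf_div.
Qed.

Definition affine_space := SpaceWithFunctions affine_regular_sheaf.

End AffineSpace.

Section Subspace.
Variables (k : fieldType) (X : space_with_functions k) (Z : set X).

(* Functions on Z that are locally restrictions of regular functions on X. *)
Definition induced_regular (A : set Z) (f : Z -> k) : Prop :=
  forall x : Z, A x -> exists (B : set X) (g : X -> k),
    [/\ open B, B (val x), regular B g &
        forall z : Z, B (val z) -> A z /\ f z = g (val z)].

Lemma open_preim (B : set X) : open B -> open [set z : Z | B (val z)].
Proof. by move=> oB; exists B. Qed.

Lemma preim_open (A : set Z) :
  open A -> exists B : set X, open B /\ A = [set z : Z | B (val z)].
Proof. by case=> B oB <-; exists B. Qed.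

Lemma induced_regular_sheaf : function_sheaf induced_regular.
Proof.
have S := regular_sheaf X.
split.
- move=> A f g _ fg rf x /rf[B [h [oB Bx rh H]]].
  exists B, h; split => // z Bz; have [Az <-] := H z Bz.
  by split => //; rewrite -fg.
- move=> A B f _ oB BA rf x Bx.
  have [C [h [oC Cx rh H]]] := rf x (BA _ Bx).
  have [B' [oB' BB']] := preim_open oB.
  have oCB : open (C `&` B') by exact: openI.
  exists (C `&` B'), h; split => //.
  + by split => //; move: Bx; rewrite BB'.
  + by apply: (reg_sub S oC) => // y [].
  + by move=> z [/H[_ ?] B'z]; split => //; rewrite BB'.
- move=> A f _ H x /H[B [oB Bx BA rf]].
  have [C [h [oC Cx rh K]]] := rf x Bx.
  by exists C, h; split => // z /K[/BA].
- move=> A c oA x Ax; have [B [oB AB]] := preim_open oA.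
  exists B, (fun=> c); rewrite AB in Ax *; split => //.
  exact: (reg_cst S).
- move=> A f g _ rf rg x Ax.
  have [B [h [oB Bx rh H]]] := rf x Ax.
  have [C [l [oC Cx rl K]]] := rg x Ax.
  have oBC : open (B `&` C) by exact: openI.
  exists (B `&` C), (fun y => h y + l y).
  split => // [|z [/H[Az ->] /K[_ ->]]]//.
  by apply: (reg_add S) => //; [apply: (reg_sub S oB)|apply: (reg_sub S oC)]
    => // y [].
- move=> A f g _ rf rg x Ax.
  have [B [h [oB Bx rh H]]] := rf x Ax.
  have [C [l [oC Cx rl K]]] := rg x Ax.
  have oBC : open (B `&` C) by exact: openI.
  exists (B `&` C), (fun y => h y * l y).
  split => // [|z [/H[Az ->] /K[_ ->]]]//.
  by apply: (reg_mul S) => //; [apply: (reg_sub S oB)|apply: (reg_sub S oC)]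
    => // y [].
- move=> A f _ rf; rewrite openE => x [Ax fx].
  have [B [h [oB Bx rh H]]] := rf x Ax.
  rewrite /interior nbhsE.
  exists [set z : Z | (B `&` [set y | h y != 0]) (val z)].
    split; first by apply: open_preim; exact: (reg_open_neq0 S).
    by split => //=; have [_ <-] := H x Bx.
  by move=> z [Bz hz]; have [Az fz] := H z Bz; split => //=; rewrite fz.
- move=> A f _ rf x [Ax /= fx].
  have [B [h [oB Bx rh H]]] := rf x Ax.
  exists (B `&` [set y | h y != 0]), (fun y => (h y)^-1); split.
  + exact: (reg_open_neq0 S).
  + by split => //=; have [_ <-] := H x Bx.
  + exact: (reg_inv S).
  + move=> z [Bz hz]; have [Az fz] := H z Bz.
    by rewrite fz; split => //; split => //=; rewrite fz.
Qed.

Definition induced_space := SpaceWithFunctions induced_regular_sheaf.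

End Subspace.

(* Closed subsets of affine space model affine varieties only over an
   algebraically closed field; irreducibility is not required. *)
Definition is_affine (k : closedFieldType) (X : space_with_functions k)
    : Prop :=
  exists (n : nat) (Z : set (affine_space k n)),
    closed Z /\ isomorphic X (induced_space Z).

Section DisjointUnion.
Variables (k : fieldType) (I : choiceType) (X : I -> space_with_functions k).

Definition sum_regular (A : set {i & X i}) (f : {i & X i} -> k) : Prop :=
  forall i, regular (existT X i @^-1` A) (f \o existT X i).

Lemma sum_open (A : set {i & X i}) i : open A -> open (existT X i @^-1` A).
Proof. by move=> /sigT_openP. Qed.

Lemma sum_regular_sheaf : function_sheaf sum_regular.
Proof.
split.
- move=> A f g oA fg rf i.
  by apply: (reg_eq (regular_sheaf (X i)) _ _ (rf i)) => [|x /fg//];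
    exact: sum_open.
- move=> A B f oA oB BA rf i.
  by apply: (reg_sub (regular_sheaf (X i)) _ _ _ (rf i));
    [exact: sum_open|exact: sum_open|move=> x /BA].
- move=> A f oA H i; apply: (reg_glue (regular_sheaf (X i))).
    exact: sum_open.
  move=> x /H[B [oB Bx BA rf]]; exists (existT X i @^-1` B); split => //.
    exact: sum_open.
  by move=> y /BA.
- by move=> A c oA i; apply: (reg_cst (regular_sheaf (X i))); exact: sum_open.
- move=> A f g oA rf rg i.
  exact: (reg_add (regular_sheaf (X i)) (sum_open i oA) (rf i) (rg i)).
- move=> A f g oA rf rg i.
  exact: (reg_mul (regular_sheaf (X i)) (sum_open i oA) (rf i) (rg i)).
- move=> A f oA rf; apply/sigT_openP => i.
  exact: (reg_open_neq0 (regular_sheaf (X i)) (sum_open i oA) (rf i)).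
- move=> A f oA rf i.
  exact: (reg_inv (regular_sheaf (X i)) (sum_open i oA) (rf i)).
Qed.

Definition disjoint_union := SpaceWithFunctions sum_regular_sheaf.

End DisjointUnion.

Section Quotient.
Local Open Scope quotient_scope.
Variables (k : fieldType) (X : space_with_functions k) (Q0 : quotType X).
Local Notation Q := (quotient_topology Q0).

Definition quotient_regular (A : set Q) (f : Q -> k) : Prop :=
  regular (\pi_Q @^-1` A : set X) (f \o \pi_Q).

Lemma quotient_regular_sheaf : function_sheaf quotient_regular.
Proof.
have S := regular_sheaf X.
split.
- by move=> A f g oA fg; apply: (reg_eq S) => // x /fg.
- by move=> A B f oA oB BA; apply: (reg_sub S) => // x /BA.
- move=> A f oA H; apply: (reg_glue S) => // x /H[B [oB Bx BA rf]].
  by exists (\pi_Q @^-1` B); split => // y /BA.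
- by move=> A c oA; exact: (reg_cst S).
- by move=> A f g oA rf rg; exact: (reg_add S oA rf rg).
- by move=> A f g oA rf rg; exact: (reg_mul S oA rf rg).
- by move=> A f oA rf; exact: (reg_open_neq0 S oA rf).
- by move=> A f oA rf; exact: (reg_inv S oA rf).
Qed.

Definition quotient_space := SpaceWithFunctions quotient_regular_sheaf.

End Quotient.

Section W2.
Variables (k : fieldType) (y : nat).

(* false indexes the chart U with coordinates (z, u1, u2), true indexes the
   chart V with coordinates (xi, v1, v2). *)
Definition charts : space_with_functions k :=
  disjoint_union (fun _ : bool => affine_space k 3).

Definition transition (p : affine_point k 3) : affine_point k 3 :=
  let z := tnth p 0 in let u1 := tnth p 1 in let u2 := tnth p 2 in
  [tuple z^-1; z ^+ 2 * u1 + z * u2 ^+ y; u2].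

(* p in U is identified with q in V; q then has nonzero first coordinate. *)
Definition glued (p q : affine_point k 3) : bool :=
  (tnth p 0 != 0) && (q == transition p).

Definition glue_rel : rel charts := fun s t =>
  match s, t with
  | existT false p, existT true q => glued p q
  | existT true q, existT false p => glued p q
  | existT _ p, existT _ q => (p : affine_point k 3) == q
  end.

Lemma transition_inj (p q : affine_point k 3) :
  tnth p 0 != 0 -> tnth q 0 != 0 -> transition p = transition q -> p = q.
Proof.
move=> p0 q0 /(congr1 val)/= [/invr_inj E0 E1 E2].
have {}E1 : tnth p 1 = tnth q 1.
  move: E1; rewrite E0 E2 => /addIr; apply: mulfI.
  by rewrite expf_neq0.
apply: eq_from_tnth => i; case: i => [[|[|[|//]]] i3].
- by rewrite (_ : Ordinal _ = 0)//; exact: val_inj.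
- by rewrite (_ : Ordinal _ = 1)//; exact: val_inj.
- by rewrite (_ : Ordinal _ = 2)//; exact: val_inj.
Qed.

Lemma glue_rel_refl : reflexive glue_rel.
Proof. by case=> -[] p /=. Qed.

Lemma glue_rel_sym : ssrbool.symmetric glue_rel.
Proof. by case=> -[] p [[] q] //=; rewrite eq_sym. Qed.

Lemma glue_rel_trans : transitive glue_rel.
Proof.
case=> -[] q [[] p] [[] r] //=.
- by move=> /eqP->.
- by move=> /eqP->.
- by move=> /[swap] /eqP->.
- move=> /andP[p0 /eqP->] /andP[r0 /eqP]/transition_inj -> //.
- by move=> /andP[_ /eqP->] /andP[_ /eqP->].
- by move=> /[swap] /eqP->.
- by move=> /eqP->.
- by move=> /eqP->.
Qed.

Canonical glue_equiv := EquivRel glue_rel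
  glue_rel_refl glue_rel_sym glue_rel_trans.

Definition W2 : space_with_functions k :=
  @quotient_space k charts {eq_quot glue_equiv}%qT.

End W2.

(* Main.v *)
Require Import Defs.
From mathcomp Require Import all_boot all_algebra complex reals.
From mathcomp Require Import mpoly.
From mathcomp Require Import classical_sets topology_structure.

(** The threefold contains a projective line: the points of U and of V whose
    last two coordinates vanish are exchanged by z |-> z^-1, since the
    deformation term z u_2^y vanishes at u_2 = 0 as soon as y > 0.  An affine
    variety contains no such line.  A regular function restricts to each of the
    two affine lines as a polynomial ([regular_line_polynomial]), say G in z and
    H in xi, with G(z) = H(z^-1) for z != 0, and this forces G to be constant
    ([polynomial_in_inverse_constant]).  So every regular function takes the
    same value at the points z = 0 and z = 1 of the line, whereas the coordinate
    functions of an affine variety separate its points. *)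

Set Implicit Arguments.
Unset Strict Implicit.
Unset Printing Implicit Defensive.

Import GRing.Theory.
Local Open Scope classical_set_scope.
Local Open Scope ring_scope.

Section OneVariable.
Variable k : closedFieldType.
Implicit Types (p q r : {poly k}) (g : k -> k).

Lemma poly_horner_eq0 p : (forall t, p.[t] = 0) -> p = 0.
Proof.
move=> p0; apply/eqP/negPn/negP => /closed_nonrootP[x].
by rewrite /root p0 eqxx.
Qed.

Lemma poly_eq_off_root p q r : r != 0 ->
  (forall t, r.[t] != 0 -> p.[t] = q.[t]) -> p = q.
Proof.
move=> r0 pq; apply/subr0_eq/(mulIf r0); rewrite mul0r.
apply: poly_horner_eq0 => t; rewrite !hornerE.
by have [->|/pq ->] := eqVneq r.[t] 0; rewrite ?mulr0// subrr mul0r.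
Qed.

(** One polynomial [q] serves both as denominator and as equation of the
    complement of the neighbourhood of [x] on which [g] is a fraction. *)
Definition rational_at g x := exists p q,
  q.[x] != 0 /\ forall t, q.[t] != 0 -> g t * q.[t] = p.[t].

(** Two fractions that represent [g] near two points agree off finitely many
    points, hence are equal.  So the reduced form of any one of them has a
    denominator without roots, that is, a constant. *)
Lemma rational_everywhere_polynomial g :
  (forall x, rational_at g x) -> exists p, g =1 horner p.
Proof.
move=> rg; have [p0 [q0 [q00 H0]]] := rg 0.
have q0n0 : q0 != 0 by apply: contraNneq q00 => ->; rewrite horner0.
have d0 : gcdp p0 q0 != 0 by rewrite gcdp_eq0 negb_and q0n0 orbT.
set p := p0 %/ gcdp p0 q0; set q := q0 %/ gcdp p0 q0.
have pE : p0 = p * gcdp p0 q0 by rewrite divpK// dvdp_gcdl.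
have qE : q0 = q * gcdp p0 q0 by rewrite divpK// dvdp_gcdr.
have cpq : coprimep p q by rewrite coprimep_div_gcd// q0n0 orbT.
have rep x : exists px qx,
    [/\ qx.[x] != 0, p * qx = px * q & g x * qx.[x] = px.[x]].
  have [px [qx [qxx Hx]]] := rg x.
  exists px, qx; split => //; last exact: Hx.
  have qxn0 : qx != 0 by apply: contraNneq qxx => ->; rewrite horner0.
  apply: (mulIf d0); rewrite mulrAC -pE -[RHS]mulrA -qE.
  apply: (@poly_eq_off_root _ _ (q0 * qx)); first by rewrite mulf_neq0.
  move=> t; rewrite hornerM mulf_eq0 negb_or => /andP[/H0 e0 /Hx ex].
  by rewrite !hornerM -e0 -ex mulrAC.
have noroot x : q.[x] != 0.
  have [px [qx [qxx pq _]]] := rep x; apply/eqP => qx0.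
  have := coprimep_root cpq.
  have /eqP : (p * qx).[x] = 0 by rewrite pq hornerM qx0 mulr0.
  rewrite hornerM mulf_eq0 (negbTE qxx) orbF => px0 /(_ x px0).
  by rewrite qx0 eqxx.
have /size_poly1P[c c0 qc] : size q == 1%N.
  apply/negPn/negP => /closed_rootP[x]; rewrite /root; exact/negP/noroot.
exists (c^-1 *: p) => x; have [px [qx [qxx pq e]]] := rep x.
apply: (mulIf qxx); rewrite e hornerZ -mulrA -hornerM pq hornerM qc hornerC.
by rewrite mulrCA mulVf// mulr1.
Qed.

(** Multiplied by [t ^+ N] with [N] the degree of [q], the right-hand side
    becomes the polynomial with reversed coefficients, of degree at most [N];
    so [p] is zero or has degree [0]. *)
Lemma polynomial_in_inverse_constant p q :
  (forall t, t != 0 -> p.[t] = q.[t^-1]) -> p.[1] = p.[0].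
Proof.
move=> pq; set N := (size q).-1.
have E : p * 'X^N = \poly_(i < N.+1) q`_(N - i).
  apply: (@poly_eq_off_root _ _ 'X); first by rewrite polyX_eq0.
  move=> t; rewrite hornerX => t0; rewrite hornerM hornerXn pq//.
  have sq : (size q <= N.+1)%N by rewrite /N leqSpred.
  rewrite (horner_coef_wide _ sq) horner_poly mulr_suml.
  rewrite (reindex_inj rev_ord_inj) /=; apply: eq_bigr => i _.
  have iN : (i <= N)%N by rewrite -ltnS.
  have tN : t ^+ N = t ^+ (N - i) * t ^+ i by rewrite -exprD subnK.
  by rewrite subSS -mulrA exprVn tN mulKf// expf_neq0.
suff /size1_polyC -> : (size p <= 1)%N by rewrite !hornerC.
have [->|p0] := eqVneq p 0; first by rewrite size_poly0.
have := size_poly N.+1 (fun i => q`_(N - i)); rewrite -E.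
by rewrite size_mulXn// -addn1 leq_add2l.
Qed.

End OneVariable.

Definition axis (k : fieldType) (t : k) : affine_point k 3 :=
  [tuple t; 0; 0].

Section Axis.
Variable k : closedFieldType.

Definition axis_poly (p : {mpoly k[3]}) : {poly k} :=
  mmap polyC (fun i => if i == 0 then 'X else 0) p.

Lemma horner_axis_poly p t : (axis_poly p).[t] = peval p (axis t).
Proof.
rewrite /axis_poly /peval /meval /mmap horner_sum; apply: eq_bigr => m _.
rewrite hornerM hornerC /mmap1 horner_prod; congr (_ * _).
apply: eq_bigr => i _; rewrite horner_exp; congr (_ ^+ _).
by case: i => [[|[|[|//]]] i3]; rewrite /= ?hornerE.
Qed.

Lemma regular_line_polynomial (f : affine_point k 3 -> k) :
  affine_regular setT f -> exists p : {poly k}, forall t, f (axis t) = p.[t].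
Proof.
move=> rf; apply: rational_everywhere_polynomial => x.
have [B [p [q [oB Bx _ H]]]] := rf (axis x) I.
have [r [rx rB]] := (zariski_openP B).1 oB _ Bx.
(* The factor [r] makes the denominator vanish outside [B]. *)
exists (axis_poly (p * r)), (axis_poly (q * r)); split.
  rewrite horner_axis_poly /peval mevalM mulf_neq0//.
  by have [] := H _ Bx.
move=> t; rewrite !horner_axis_poly /peval !mevalM.
rewrite mulf_eq0 negb_or => /andP[qt /rB/H[_ ->]].
by rewrite mulrA divfK.
Qed.

End Axis.

Section ProjectiveLine.
Local Open Scope quotient_scope.
Variables (k : closedFieldType) (y : nat).

Definition chart_point (b : bool) (p : affine_point k 3) : W2 k y :=
  \pi_{eq_quot (glue_equiv k y)} (existT _ b p : charts k).

Lemma chart_point_glue (t : k) : (0 < y)%N -> t != 0 ->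
  chart_point false (axis t) = chart_point true (axis t^-1).
Proof.
move=> y0 t0; apply/eqmodP => /=; rewrite /glued t0 /=.
apply/eqP/val_inj => /=.
by rewrite !(tnth_nth 0) /= expr0n gtn_eqF// !mulr0 addr0.
Qed.

Lemma chart_point_inj b : injective (chart_point b).
Proof. by case: b => p q /eqmodP/= /eqP. Qed.

Lemma regular_chart_point (f : W2 k y -> k) b :
  regular setT f -> affine_regular setT (f \o chart_point b).
Proof. by move=> /(_ b). Qed.

Lemma regular_constant_line (f : W2 k y -> k) : (0 < y)%N ->
  regular setT f ->
  f (chart_point false (axis 1)) = f (chart_point false (axis 0)).
Proof.
move=> y0 rf.
have [p fp] := regular_line_polynomial (regular_chart_point false rf).
have [q fq] := regular_line_polynomial (regular_chart_point true rf).
rewrite /= in fp fq; rewrite !fp; apply: (@polynomial_in_inverse_constant _ _ q).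
by move=> t t0; rewrite -fp -fq chart_point_glue.
Qed.

End ProjectiveLine.

Lemma regular_coordinate (k : fieldType) n (Z : set (affine_space k n))
    (i : 'I_n) :
  regular (setT : set (induced_space Z)) (fun z => tnth (val z) i).
Proof.
move=> x _; exists setT, (fun p => tnth p i); split => //; first exact: openT.
move=> p _; exists setT, 'X_i, 1; split => //; first exact: openT.
by move=> q _; rewrite /peval meval1 mevalXU divr1 oner_eq0.
Qed.

Lemma affine_separated (k : closedFieldType) (X : space_with_functions k)
    (a b : X) : is_affine X ->
  (forall f : X -> k, regular setT f -> f a = f b) -> a = b.
Proof.
move=> [n [Z [_ [phi [psi [[_ mphi] _ phiK _]]]]]] fab.
apply: (can_inj phiK); apply/val_inj/eq_from_tnth => i.
have := mphi setT _ openT (regular_coordinate (Z := Z) i).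
by rewrite preimage_setT => /fab.
Qed.

Lemma W2_not_affine (k : closedFieldType) (y : nat) : (0 < y)%N ->
  ~ is_affine (W2 k y).
Proof.
move=> y0 /affine_separated sep.
have /chart_point_inj/(congr1 (fun p : affine_point k 3 => tnth p 0)) :=
  sep _ _ (fun f => regular_constant_line y0 (f := f)).
by rewrite !(tnth_nth 0) /= => /eqP; rewrite oner_eq0.
Qed.

Theorem corollary1p14 (R : realType) (y : nat) (hy : (2 <= y)%N) :
  ~ is_affine (W2 R[i] y).
Proof. exact/W2_not_affine/ltnW. Qed.
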